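(* Let $\mathcal{G}$ be an additive subgroup of $\mathbb{R}$, $n$ a positive integer, and $c,m\in\mathcal{G}$ with $c>0$, $m\geq 0$. For each $k\in\{0,1,\ldots,n-1\}$, each equivalence class $T$ of the relation $\sim$ on $S$ contains exactly one $k$-skeletal area vector, namely the element $g\in T$ of smallest $\mathrm{area}(g)$ among those elements of $T$ satisfying $\mathrm{pos}(g)>k$.
   Context: An area vector is $g=(g_0,\ldots,g_{n-1})\in\mathcal{G}^n$ with $g_{i+1}\leq g_i+m$ for $0\leq i<n-1$; $\mathrm{AV}_n$ is the set of area vectors. The cycling operator $C:\mathcal{G}^n\to\mathcal{G}^n$ is $C(g_0,g_1,\ldots,g_{n-1})=(g_1,\ldots,g_{n-1},g_0-c)$; it is a bijection and $C^j$ denotes its $j$-th power for $j\in\mathbb{Z}$. Let $\mathrm{area}(g)=g_0+\cdots+g_{n-1}$ (note $\mathrm{area}(C(g))=\mathrm{area}(g)-c$). Let $\mathrm{pos}(g)\in\{0,\ldots,n\}$ be the largest $\ell$ such that the last $\ell$ entries of $g$ are strictly positive. Let $S=\{g\in\mathrm{AV}_n: g_0\leq c,\ g_{n-1}>0\}$, and for $g,h\in S$ write $g\sim h$ iff $h=C^j(g)$ for some $j\in\mathbb{Z}$ (an equivalence relation on $S$). For $k\in\{0,\ldots,n-1\}$, an area vector $g$ is $k$-skeletal iff: (A0) $g_0\leq c$; (A1) $g_i>0$ for all $i\in\{n-k-1,\ldots,n-1\}$; (A2) there is no $i\in\{0,\ldots,n-k-1\}$ with $g_i,g_{i+1},\ldots,g_{i+k}$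 all strictly greater than $c$. *)

(* Defs.v *)
From HB Require Import structures.
From mathcomp Require Import all_boot all_order all_algebra.
From mathcomp Require Import boolp classical_sets reals.

Set Implicit Arguments.
Unset Strict Implicit.
Unset Printing Implicit Defensive.

Import Order.TTheory GRing.Theory Num.Theory.

Local Open Scope classical_set_scope.
Local Open Scope ring_scope.

(* An element (g_0, ..., g_{n-1}) of G^n is an n-tuple over R with entries in
   the subgroup G; g`_i is g_i for i < n (and 0 for i >= n). *)

Definition area_vector (R : realType) (G : zmodClosed R) (n : nat) (m : R)
    (g : n.-tuple R) : Prop :=
  (forall i : nat, (i < n)%N -> g`_i \in G) /\
  (forall i : nat, (i.+1 < n)%N -> g`_(i.+1) <= g`_i + m).

Definition cycling (R : realType) (n : nat) (c : R) (g : n.-tuple R) :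
    n.-tuple R :=
  [tuple (if (i.+1 < n)%N then g`_(i.+1) else g`_0 - c) | i < n].

(* The inverse of cycling: (g_{n-1} + c, g_0, ..., g_{n-2}); see cyclingK and
   cycling_invK. *)
Definition cycling_inv (R : realType) (n : nat) (c : R) (g : n.-tuple R) :
    n.-tuple R :=
  [tuple (if (0 < i)%N then g`_(i.-1) else g`_(n.-1) + c) | i < n].

Definition cycling_pow (R : realType) (n : nat) (c : R) (j : int)
    (g : n.-tuple R) : n.-tuple R :=
  match j with
  | Posz a => iter a (cycling c) g
  | Negz a => iter a.+1 (cycling_inv c) g
  end.

Definition area (R : realType) (n : nat) (g : n.-tuple R) : R :=
  \sum_(i < n) g`_i.

Definition pos (R : realType) (n : nat) (g : n.-tuple R) : nat :=
  (\max_(l < n.+1 | [forall i : 'I_n, (n - l <= i)%N ==> (0 < g`_i)%R]) l)%N.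

Definition Sset (R : realType) (G : zmodClosed R) (n : nat) (c m : R) :
    set (n.-tuple R) :=
  [set g | [/\ area_vector G m g, g`_0 <= c & 0 < g`_(n.-1)]].

Definition cyc_equiv (R : realType) (n : nat) (c : R) (g h : n.-tuple R) :
    Prop :=
  exists j : int, h = cycling_pow c j g.

Definition cyc_class (R : realType) (G : zmodClosed R) (n : nat) (c m : R)
    (T : set (n.-tuple R)) : Prop :=
  exists2 g, Sset G c m g & T = [set h | Sset G c m h /\ cyc_equiv c g h].

(* For k < n, the truncated subtraction n - k - 1 is the true one. *)
Definition skeletal (R : realType) (G : zmodClosed R) (n : nat) (c m : R)
    (k : nat) (g : n.-tuple R) : Prop :=
  [/\ area_vector G m g,
      g`_0 <= c,
      (forall i : nat, (n - k - 1 <= i <= n - 1)%N -> 0 < g`_i) &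
      ~ (exists2 i : nat, (i <= n - k - 1)%N &
           forall j : nat, (j <= k)%N -> c < g`_(i + j))].

Section Facts.
Variables (R : realType) (n : nat) (c : R).
Implicit Types (g h : n.-tuple R).

Lemma nth_cycling g i : (i < n)%N ->
  (cycling c g)`_i = if (i.+1 < n)%N then g`_(i.+1) else g`_0 - c.
Proof.
by move=> lt_in; rewrite -[i]/(val (Ordinal lt_in)) -tnth_nth tnth_mktuple.
Qed.

Lemma nth_cycling_inv g i : (i < n)%N ->
  (cycling_inv c g)`_i = if (0 < i)%N then g`_(i.-1) else g`_(n.-1) + c.
Proof.
by move=> lt_in; rewrite -[i]/(val (Ordinal lt_in)) -tnth_nth tnth_mktuple.
Qed.

Lemma cyclingK : cancel (@cycling R n c) (cycling_inv c).
Proof.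
move=> g; apply: eq_from_tnth => -[i lt_in].
rewrite !(tnth_nth 0) [LHS]nth_cycling_inv //=.
case: i lt_in => [|i] lt_in /=; last by rewrite nth_cycling ?lt_in // ltnW.
by rewrite nth_cycling ?prednK // ltnn subrK.
Qed.

Lemma cycling_invK : cancel (@cycling_inv R n c) (cycling c).
Proof.
move=> g; apply: eq_from_tnth => -[i lt_in].
rewrite !(tnth_nth 0) [LHS]nth_cycling //=.
case: ltnP => [lt_i1n|le_ni1]; first by rewrite nth_cycling_inv.
have n_gt0 : (0 < n)%N by apply: leq_ltn_trans lt_in.
have -> : i = n.-1 by apply/eqP; rewrite -eqSS prednK // eqn_leq lt_in.
by rewrite nth_cycling_inv //= addrK.
Qed.

Lemma cycling_powS j g :
  cycling_pow c (j + 1) g = cycling c (cycling_pow c j g).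
Proof.
case: j => [a|[|a]] /=; first by rewrite addn1.
- by rewrite cycling_invK.
- by rewrite cycling_invK subn1.
Qed.

Lemma cycling_powP j g :
  cycling_pow c (j - 1) g = cycling_inv c (cycling_pow c j g).
Proof. by rewrite -{2}[j](subrK 1) cycling_powS cyclingK. Qed.

Lemma cycling_powD i j g :
  cycling_pow c (i + j) g = cycling_pow c i (cycling_pow c j g).
Proof.
elim/int_ind: i => [|i IH|i IH]; first by rewrite add0r.
- by rewrite -addn1 PoszD addrAC !cycling_powS IH.
- by rewrite -addn1 PoszD opprD addrAC !cycling_powP IH.
Qed.

Lemma cyc_equiv_refl g : cyc_equiv c g g.
Proof. by exists 0. Qed.

Lemma cyc_equiv_sym g h : cyc_equiv c g h -> cyc_equiv c h g.
Proof. by case=> j ->; exists (- j); rewrite -cycling_powD addNr. Qed.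

Lemma cyc_equiv_trans g h f :
  cyc_equiv c g h -> cyc_equiv c h f -> cyc_equiv c g f.
Proof. by case=> i -> [j ->]; exists (j + i); rewrite cycling_powD. Qed.

Lemma area_cycling g : (0 < n)%N -> area (cycling c g) = area g - c.
Proof.
move=> n_gt0; rewrite /area.
rewrite -(big_mkord xpredT (fun i => (cycling c g)`_i)).
rewrite -(big_mkord xpredT (fun i => g`_i)).
have nth_c := nth_cycling g; case: n n_gt0 g nth_c => // p _ g nth_c.
rewrite big_nat_recr //= big_nat_recl //= nth_c // ltnn addrA; congr (_ - c).
rewrite addrC; congr (_ + _); apply: eq_big_nat => i /andP[_ lt_ip].
by rewrite nth_c ?ltnS ?lt_ip // ltnW.
Qed.

End Facts.

(* Main.v *)
(* Extend g to the bi-infinite sequence u with u_(q+n) = u_q - c, so that C^j(g)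
   is the stretch of u of length n starting at j.  An element of S is a stretch
   that ends just before a descent u_(p-1) > 0 >= u_p; such a descent also makes
   u_(q+1) <= u_q + m hold across the seam, hence for all q, so all C^j(g)
   are area vectors.  As g_i > c means that the entry one period later is
   positive, C^j(g) is k-skeletal if and only if its last k + 1 entries form the
   last run of k + 1 consecutive positive entries in all of u.  Such a last run
   exists, since u tends to -oo at +oo and to +oo at -oo, and it is unique; as
   the area of C^j(g) decreases with j, last means of smallest area. *)

Require Import Defs.
From mathcomp Require Import all_boot all_order all_algebra.
From mathcomp Require Import boolp classical_sets reals.
From mathcomp Require Import zify ring lra.

Set Implicit Arguments.
Unset Strict Implicit.
Unset Printing Implicit Defensive.

Import Order.TTheory GRing.Theory Num.Theory.
Local Open Scope classical_set_scope.
Local Open Scope ring_scope.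

(** This is the sequence u. Taking the head of a power of [cycling] defines it at every integer
    index without dividing by [n]. *)
Definition unroll (R : realType) (n : nat) (c : R) (g : n.-tuple R)
    (q : int) : R :=
  (cycling_pow c q g)`_0.

Definition pos_run (R : realType) (u : int -> R) (k : nat) (q : int) : Prop :=
  forall i : nat, (i <= k)%N -> 0 < u (q + i%:Z).

Lemma lt_pos (R : realType) (n k : nat) (g : n.-tuple R) : (k < n)%N ->
  (k < pos g)%N <->
  forall i : nat, (n - k - 1 <= i <= n - 1)%N -> 0 < g`_i.
Proof.
move=> lt_kn; split=> [lt_k_pos i /andP[le_i lt_i] | gpos].
  rewrite ltNge; apply/negP => gi_le0.
  move: lt_k_pos; rewrite ltnNge => /negP; apply; apply/bigmax_leqP => l.
  have lt_in : (i < n)%N by lia.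
  move=> /forallP/(_ (Ordinal lt_in)) /= /implyP gl.
  rewrite leqNgt; apply/negP => lt_kl.
  by have := gl ltac:(lia); rewrite ltNge gi_le0.
have lt_k1n : (k.+1 < n.+1)%N by [].
(* The value [k.+1] is itself a candidate in the maximum defining [pos]. *)
apply: (@leq_trans (Ordinal lt_k1n)) => //.
apply: (@leq_bigmax_cond _ _ (fun l : 'I_n.+1 => nat_of_ord l)).
apply/forallP => i; apply/implyP => /= le_i; apply: gpos.
by have := ltn_ord i; lia.
Qed.

Section Unroll.
Variables (R : realType) (n : nat) (c : R).
Hypothesis n_gt0 : (0 < n)%N.
Implicit Types (g : n.-tuple R) (q j a : int).

Lemma nth_cycling_pow g j i : (i < n)%N ->
  (cycling_pow c j g)`_i = unroll c g (j + i%:Z).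
Proof.
elim: i j => [|i IH] j lt_in; first by rewrite addr0.
have -> : j + i.+1%:Z = (j + 1) + i%:Z by lia.
rewrite -IH ?(ltnW lt_in) // cycling_powS nth_cycling ?lt_in //.
exact: ltnW.
Qed.

Lemma unroll_nth g i : (i < n)%N -> unroll c g i%:Z = g`_i.
Proof. by move=> lt_in; rewrite -[i%:Z]add0r -nth_cycling_pow. Qed.

Lemma unrollDn g q : unroll c g (q + n%:Z) = unroll c g q - c.
Proof.
have -> : q + n%:Z = (q + 1) + (n.-1)%:Z by lia.
rewrite -nth_cycling_pow ?ltn_predL // cycling_powS nth_cycling ?ltn_predL //.
by rewrite prednK // ltnn.
Qed.

Lemma unrollDMn g q a : unroll c g (q + a * n%:Z) = unroll c g q - a%:~R * c.
Proof.
elim/int_ind: a => [|a IH|a IH]; first by rewrite !mul0r addr0 subr0.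
  have -> : q + a.+1%:Z * n%:Z = q + a%:Z * n%:Z + n%:Z by lia.
  by rewrite unrollDn IH -addn1 PoszD intrD; ring.
apply: (@addIr _ (- c)); rewrite -unrollDn.
have -> : q + - a.+1%:Z * n%:Z + n%:Z = q + - a%:Z * n%:Z by lia.
by rewrite IH -addn1 PoszD !intrN intrD; ring.
Qed.

Lemma int_period q : exists i a, (i < n)%N /\ q = i%:Z + a * n%:Z :> int.
Proof.
have n_neq0 : n%:Z != 0 by lia.
exists `|(q %% n%:Z)%Z|%N, (q %/ n%:Z)%Z.
have := divz_eq q n; have := modz_ge0 q n_neq0; have := ltz_mod q n_neq0.
by split; lia.
Qed.

Lemma area_cycling_pow g j : area (cycling_pow c j g) = area g - j%:~R * c.
Proof.
elim/int_ind: j => [|j IH|j IH]; first by rewrite mul0r subr0.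
  by rewrite -addn1 PoszD cycling_powS area_cycling // IH intrD; ring.
apply: (@addIr _ (- c)); rewrite -area_cycling // -cycling_powS.
have -> : - j.+1%:Z + 1 = - j%:Z by lia.
by rewrite IH -addn1 PoszD !intrN intrD; ring.
Qed.

Lemma area_vector_cycling_pow (G : zmodClosed R) (m : R) g j :
  c \in G -> 0 <= m -> Sset G c m g -> area_vector G m (cycling_pow c j g).
Proof.
move=> cG m_ge0 [[gG g_step] g0_le gn_gt0].
have uG q : unroll c g q \in G.
  have [i [a [lt_in ->]]] := int_period q.
  by rewrite unrollDMn unroll_nth // mulrzl rpredB ?gG // rpredMz.
have u_step q : unroll c g (q + 1) <= unroll c g q + m.
  have [i [a [lt_in ->]]] := int_period q.
  rewrite addrAC !unrollDMn (unroll_nth g lt_in) addrAC lerD2r.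
  have -> : i%:Z + 1 = i.+1%:Z by lia.
  have [lt_i1n|le_ni1] := ltnP i.+1 n; first by rewrite unroll_nth // g_step.
  (* Across the seam the next entry is [g_0 - c <= 0], while the last entry is positive and
     [m >= 0]. *)
  have -> : i.+1%:Z = 0%:Z + n%:Z by lia.
  have -> : i = n.-1 by lia.
  rewrite unrollDn unroll_nth //; lra.
split=> i lt_in; rewrite !nth_cycling_pow // ?(ltnW lt_in) //.
have -> : j + i.+1%:Z = j + i%:Z + 1 by lia.
exact: u_step.
Qed.

Section Runs.
Variables (k : nat) (lt_kn : (k < n)%N).

Lemma pos_run_last_entries g j :
  (forall i : nat, (n - k - 1 <= i <= n - 1)%N -> 0 < (cycling_pow c j g)`_i) <->
  pos_run (unroll c g) k (j + (n - k - 1)%N%:Z).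
Proof.
split=> [gpos i le_ik | run i le_i].
  rewrite -addrA -PoszD -nth_cycling_pow; last by lia.
  by apply: gpos; lia.
rewrite nth_cycling_pow; last by lia.
have -> : j + i%:Z = j + (n - k - 1)%N%:Z + (i - (n - k - 1))%N%:Z by lia.
by apply: run; lia.
Qed.

Hypothesis c_gt0 : 0 < c.

(** Each period further back adds [c > 0] to every entry. *)
Lemma pos_run_sub g q (a : nat) :
  pos_run (unroll c g) k (q + a%:Z * n%:Z) -> pos_run (unroll c g) k q.
Proof.
move=> qrun i le_ik; have := qrun i le_ik.
rewrite addrAC unrollDMn subr_gt0; apply: le_lt_trans.
by rewrite mulr_ge0 ?ler0n // ltW.
Qed.

(** (A1) is the run itself, (A0) makes u nonpositive at [j + n], and (A2) forbids runs inside the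
    period starting there. A later run, moved back by whole periods, would have to fit in that
    period or cross its end. *)
Lemma skeletal_cycling_pow (G : zmodClosed R) (m : R) g j :
  area_vector G m (cycling_pow c j g) ->
  skeletal G c m k (cycling_pow c j g) <->
  pos_run (unroll c g) k (j + (n - k - 1)%N%:Z) /\
  (forall q, pos_run (unroll c g) k q -> q <= j + (n - k - 1)%N%:Z).
Proof.
move=> AVg.
have gt_c i : (i < n)%N ->
    (c < (cycling_pow c j g)`_i) = (0 < unroll c g (j + n%:Z + i%:Z)).
  by move=> lt_in; rewrite nth_cycling_pow // addrAC unrollDn subr_gt0.
have seam : ((cycling_pow c j g)`_0 <= c) = (unroll c g (j + n%:Z) <= 0).
  by rewrite leNgt gt_c // addr0 -leNgt.
split=> [[_ g0_le last_gt0 no_run] | [run run_max]].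
  split=> [|q qrun]; first exact/pos_run_last_entries.
  rewrite leNgt; apply/negP => lt_q; rewrite seam in g0_le.
  have missed p : unroll c g p <= 0 -> q <= p -> p <= q + k%:Z -> False.
    move=> up_le0 le_qp le_pq; have := qrun `|p - q|%N ltac:(lia).
    have -> : q + `|p - q|%N%:Z = p by lia.
    by rewrite ltNge up_le0.
  (* A later run that starts no further than [j + n] would cover [j + n]. *)
  have [le_q|gt_q] := leP q (j + n%:Z); first by apply: (missed _ g0_le); lia.
  have [i [a [lt_in q_eq]]] := int_period (q - (j + n%:Z)).
  have a_ge0 : 0 <= a by nia.
  have q_eq' : q = j + n%:Z + i%:Z + `|a|%N%:Z * n%:Z by lia.
  have {}run : pos_run (unroll c g) k (j + n%:Z + i%:Z).
    by apply: (@pos_run_sub _ _ `|a|%N); rewrite -q_eq'.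
  have [le_i|gt_i] := leqP i (n - k - 1).
    apply: no_run; exists i => // l le_lk.
    rewrite gt_c; last by lia.
    by rewrite PoszD addrA; apply: run.
  (* Now the run reaches [j + 2n], where u is at most [- c]. *)
  have := run (n - i)%N ltac:(lia).
  have -> : j + n%:Z + i%:Z + (n - i)%N%:Z = j + n%:Z + n%:Z by lia.
  rewrite unrollDn subr_gt0 => /lt_le_trans/(_ g0_le).
  by move=> /(lt_trans c_gt0); rewrite ltxx.
split=> //; last 2 first.
- exact/pos_run_last_entries.
- case=> i le_i i_run.
  suff /run_max : pos_run (unroll c g) k (j + n%:Z + i%:Z) by lia.
  move=> l le_lk; rewrite -addrA -PoszD -gt_c; first exact: i_run.
  by lia.
(* A positive entry at [j + n] would let the run shift one place to the right. *)
rewrite seam leNgt; apply/negP => u_gt0.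
suff /run_max : pos_run (unroll c g) k (j + (n - k - 1)%N%:Z + 1) by lia.
move=> i; rewrite leq_eqVlt => /orP[/eqP -> | lt_ik].
  by have -> : j + (n - k - 1)%N%:Z + 1 + k%:Z = j + n%:Z by lia.
have -> : j + (n - k - 1)%N%:Z + 1 + i%:Z = j + (n - k - 1)%N%:Z + i.+1%:Z.
  by lia.
exact: run.
Qed.

Lemma exists_last_pos_run g :
  exists s : int, pos_run (unroll c g) k s /\
    forall q, pos_run (unroll c g) k q -> q <= s.
Proof.
pose M := \sum_(i < n) `|g`_i|.
have M_ge0 : 0 <= M by apply: sumr_ge0.
have le_M i : (i < n)%N -> `|g`_i| <= M.
  by move=> lt_in; rewrite /M (bigD1 (Ordinal lt_in)) //= lerDl sumr_ge0.
(* Shifting by [N] periods changes entries by more than [M], so a run starts at [- N * n] and none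
   starts at or beyond [N * n]. *)
pose N := Num.bound (M / c).
have lt_MN : M < N%:R * c.
  by rewrite -ltr_pdivrMr // archi_boundP // divr_ge0 // ltW.
have run0 : pos_run (unroll c g) k (- N%:Z * n%:Z).
  move=> i le_ik; have lt_in : (i < n)%N by lia.
  rewrite addrC unrollDMn unroll_nth // intrN mulNr opprK.
  by have := le_M i lt_in; rewrite ler_norml => /andP[]; lra.
have run_lt q : pos_run (unroll c g) k q -> q < N%:Z * n%:Z.
  move=> /(_ 0%N isT); rewrite addr0.
  have [i [a [lt_in ->]]] := int_period q.
  rewrite unrollDMn unroll_nth // => u_gt0.
  suff: a < N%:Z by nia.
  rewrite ltNge; apply/negP => le_Na.
  have : N%:R * c <= a%:~R * c.
    by rewrite ler_pM2r // -[N%:R]/(N%:Z%:~R) ler_int.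
  by have := le_M i lt_in; rewrite ler_norml => /andP[]; lra.
(* Starts are counted from [- N * n], so that the maximum is taken over naturals. *)
pose P b := `[< pos_run (unroll c g) k (- N%:Z * n%:Z + b%:Z) >].
have exP : exists b, P b by exists 0%N; apply/asboolP; rewrite addr0.
have ubP b : P b -> (b <= 2 * N * n)%N by move=> /asboolP/run_lt; lia.
case: (ex_maxnP exP ubP) => b /asboolP b_run b_max.
exists (- N%:Z * n%:Z + b%:Z); split=> // q q_run.
have [le_q|lt_q] := leP q (- N%:Z * n%:Z); first by lia.
have q_eq : q = - N%:Z * n%:Z + `|(q + N%:Z * n%:Z)%R|%N%:Z by lia.
have : P `|(q + N%:Z * n%:Z)%R|%N by apply/asboolP; rewrite -q_eq.
by move=> /b_max; lia.
Qed.

End Runs.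
End Unroll.

Theorem theorem2p9 (R : realType) (G : zmodClosed R) (n : nat) (c m : R)
    (n_gt0 : (0 < n)%N) (cG : c \in G) (mG : m \in G)
    (c_gt0 : 0 < c) (m_ge0 : 0 <= m)
    (k : nat) (lt_kn : (k < n)%N)
    (T : set (n.-tuple R)) (classT : cyc_class G c m T) :
  exists g : n.-tuple R,
    [/\ T g /\ skeletal G c m k g,
        (forall h : n.-tuple R, T h -> skeletal G c m k h -> h = g),
        (k < pos g)%N &
        (forall h : n.-tuple R,
           T h -> (k < pos h)%N -> h <> g -> area g < area h)].
Proof.
case: classT => f Sf ->.
have AV j := area_vector_cycling_pow n_gt0 j cG m_ge0 Sf.
have skelP j := skeletal_cycling_pow n_gt0 lt_kn c_gt0 (AV j).
have [s [s_run s_max]] := exists_last_pos_run n_gt0 lt_kn c_gt0 f.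
(* This shift makes the last [k + 1] entries begin at [s]. *)
pose j0 : int := s - (n - k - 1)%N%:Z.
have j0E : j0 + (n - k - 1)%N%:Z = s by rewrite subrK.
have skel0 : skeletal G c m k (cycling_pow c j0 f) by apply/skelP; rewrite j0E.
have [_ head_le last_gt0 _] := skel0.
exists (cycling_pow c j0 f); split.
- split=> //; split; last by exists j0.
  by split=> //; apply: last_gt0; lia.
- move=> _ [_ [j ->]] /skelP[j_run j_max]; congr (cycling_pow c _ f).
  by have := j_max _ s_run; have := s_max _ j_run; lia.
- exact/lt_pos.
(* The last entries of such a vector form a run, so its shift is at most [j0]; a strictly smaller
   shift has strictly larger area. *)
- move=> _ [_ [j ->]] /(lt_pos _ lt_kn).
  move=> /(pos_run_last_entries _ n_gt0 lt_kn)/s_max le_js neq.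
  have lt_jj0 : j < j0.
    have [//|lt_0j|eq_j] := ltgtP j j0; first by lia.
    by case: neq; rewrite eq_j.
  by rewrite !area_cycling_pow // ltrD2l ltrN2 ltr_pM2r // ltr_int.
Qed.
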